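(* Assume that for every $i\in\mathcal{M}$, $$r\mathbf{I}_n-[A(i)+A^{\top}(i)+C^{\top}(i)C(i)]>0,\qquad r\mathbf{I}_n-[A(i)+A^{\top}(i)+\widehat{A}(i)+\widehat{A}^{\top}(i)]>0,$$ and $$Q(i)\ge0,\qquad \widehat{Q}(i)\ge0,\qquad R(i)>0 .$$ Then the system of coupled algebraic Riccati equations $$ \left\{ \begin{aligned} rP(i)=\;&P(i)A(i)+A^{\top}(i)P(i)+C^{\top}(i)P(i)C(i)+Q(i)-S^{\top}(i)\widetilde{R}^{-1}(i)S(i)+\sum_{j\in\mathcal{M}}\lambda_{ij}P(j),\\ \widetilde{R}(i)=\;&R(i)+D^{\top}(i)P(i)D(i)>0, \end{aligned} \right.\qquad i\in\mathcal{M}, $$ where $S(i)=B^{\top}(i)P(i)+D^{\top}(i)P(i)C(i)$, admits a solution $P=(P(1),\ldots,P(M))\in\mathcal{M}(\mathbb{S}^n_+)$.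
   Context: $\mathcal{M}=\{1,\ldots,M\}$ is a finite set and $(\lambda_{ij})_{i,j\in\mathcal{M}}$ is the generator of a continuous-time Markov chain on $\mathcal{M}$: $\lambda_{ij}\ge0$ for $i\ne j$ and $\sum_{j\in\mathcal{M}}\lambda_{ij}=0$ for each $i$. $r>0$ is a constant. For each $i\in\mathcal{M}$, $A(i),\widehat{A}(i),C(i)\in\mathbb{R}^{n\times n}$ and $B(i),D(i)\in\mathbb{R}^{n\times k}$ are constant matrices, and $Q(i),\widehat{Q}(i)\in\mathbb{R}^{n\times n}$, $R(i)\in\mathbb{R}^{k\times k}$ are constant symmetric matrices. For a symmetric matrix $G$, $G\ge0$ (resp. $G>0$) means positive semi-definite (resp. positive definite); $\mathbf{I}_n$ is the identity matrix. $\mathbb{S}^n_+$ is the set of $n\times n$ symmetric positive semi-definite real matrices, and $\mathcal{M}(\mathbb{S}^n_+)$ is the set of tuples $P=(P(1),\ldots,P(M))$ with $P(i)\in\mathbb{S}^n_+$ for all $i\in\mathcal{M}$. *)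

(* Defs.v *)
From HB Require Import structures.
From mathcomp Require Import all_boot all_order all_algebra.
From mathcomp Require Import reals.

Set Implicit Arguments.
Unset Strict Implicit.
Unset Printing Implicit Defensive.

Import Order.TTheory GRing.Theory Num.Theory.
Local Open Scope ring_scope.

Section MatrixOrder.
Variables (K : realType) (n : nat).
Implicit Types G : 'M[K]_n.

(* Over the reals a nonnegative quadratic form does not force symmetry, so
   symmetry is part of both definitions. *)
Definition possemidefmx G :=
  G \is symmetricmx /\ forall x : 'cV[K]_n, 0 <= (x^T *m G *m x) 0 0.

Definition posdefmx G :=
  G \is symmetricmx /\
  forall x : 'cV[K]_n, x != 0 -> 0 < (x^T *m G *m x) 0 0.

End MatrixOrder.

Definition is_generator (K : realType) (M : nat) (lam : 'M[K]_M) :=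
  (forall i j, i != j -> 0 <= lam i j) /\ (forall i, \sum_j lam i j = 0).

Section Riccati.
Variables (K : realType) (M n k : nat).
Variables (lam : 'M[K]_M) (r : K).
Variables (A C : 'I_M -> 'M[K]_n) (B D : 'I_M -> 'M[K]_(n, k)).
Variables (Q : 'I_M -> 'M[K]_n) (Rw : 'I_M -> 'M[K]_k).
Variable P : 'I_M -> 'M[K]_n.

Definition riccati_S (i : 'I_M) : 'M[K]_(k, n) :=
  (B i)^T *m P i + (D i)^T *m P i *m C i.

Definition riccati_Rtilde (i : 'I_M) : 'M[K]_k :=
  Rw i + (D i)^T *m P i *m D i.

(* [invmx] is the identity on singular matrices; the positivity conjunct makes
   [riccati_Rtilde i] invertible. *)
Definition solves_coupled_riccati :=
  forall i : 'I_M,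
    r *: P i =
      P i *m A i + (A i)^T *m P i + (C i)^T *m P i *m C i + Q i
      - (riccati_S i)^T *m invmx (riccati_Rtilde i) *m riccati_S i
      + \sum_j lam i j *: P j
    /\ posdefmx (riccati_Rtilde i).

End Riccati.

(* Main.v *)
From HB Require Import structures.
Require Import Defs.
From mathcomp Require Import all_boot all_order all_algebra.
From mathcomp Require Import reals.
From mathcomp Require Import ring lra.
From mathcomp Require Import boolp classical_sets topology normedtype derive.
Import Order.TTheory GRing.Theory Num.Theory.
Import numFieldNormedType.Exports.
Local Open Scope ring_scope.

Set Implicit Arguments.
Unset Strict Implicit.
Unset Printing Implicit Defensive.

(** The equation says that [riccati_defect] vanishes, where
    [riccati_defect Q P] is [L P + S^T Rt^-1 S - Q] with [Rt = R + D^T P D] and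
    [L] the Lyapunov operator
    [L P i = r P i - P i A i - (A i)^T P i - (C i)^T P i C i - sum_j lam i j P j].
    A family [P >= 0] with nonnegative defect is called a supersolution below.

    Everything rests on the positivity of Lyapunov operators: as soon as some
    positive definite [X] has [L X > 0], the inequality [L P >= 0] forces
    [P >= 0] ([lyap_semidef]). The reason is a maximum principle: if [P >= 0]
    and [x^T (P i) x = 0], every term of [x^T (L P i) x] is nonpositive
    ([lyap_ker]). Positivity makes [L] injective, hence bijective, on families of
    symmetric matrices ([lyap_surj]).

    Replacing [A] and [C] by [A + B Th] and [C + D Th] gives the Lyapunov
    operator of the system driven by the feedback [Th]. Completing the square
    ([complete_square]) shows that
    [L_Th P - (Q + Th^T R Th) = defect P - (Th - Th_P)^T Rt (Th - Th_P)], with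
    [Th_P = - Rt^-1 S].

    Suppose first [Q > 0] ([riccati_strict]). The assumption on
    [r - (A + A^T + C^T C)] makes [c I] a supersolution for [c] large. Among the
    supersolutions [0 <= P <= c I], which form a compact set, take one of least
    trace. With [Th = Th_P], [L_Th P = defect P + Q + Th^T R Th > 0], hence
    [L_Th] is positive and invertible. The Newton iterate [P'], solution of
    [L_Th P' = Q + Th^T R Th], satisfies [0 <= P' <= P] and is again a
    supersolution by completing the square. Minimality gives [P' = P], that is,
    [defect P = 0].

    For [Q >= 0] ([riccati_semidefinite]), solve the equation with [Q + e I] for
    [0 < e <= 1]. These solutions lie in the same compact set [0 <= P <= c I] and
    have defect [e I] for [Q]. Hence zero is the minimum, over this set, of the
    squared norm of the defect times [det Rt ^ 2], a factor that makes it
    polynomial in [P]. *)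

(** * Bilinear and quadratic forms of matrices *)

Section Forms.
Variable K : realType.

Lemma symmxP n (G : 'M[K]_n) : reflect (G^T = G) (G \is symmetricmx).
Proof.
apply: (iffP idP) => [/is_hermitianmxP/=|GT].
  by rewrite expr0 scale1r map_mx_id //; move=> {2}->.
by apply/is_hermitianmxP; rewrite /= expr0 scale1r map_mx_id // GT.
Qed.

Section Transpose.
Variables m n : nat.
Implicit Types G H : 'M[K]_(m, n).

Lemma trmxD G H : (G + H)^T = G^T + H^T. Proof. exact: linearD. Qed.
Lemma trmxB G H : (G - H)^T = G^T - H^T. Proof. exact: linearB. Qed.
Lemma trmxZ a G : (a *: G)^T = a *: G^T. Proof. exact: linearZ. Qed.
Lemma trmx_sum (I : finType) (F : I -> 'M[K]_(m, n)) :
  (\sum_i F i)^T = \sum_i (F i)^T.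
Proof. exact: linear_sum. Qed.

End Transpose.

Definition bform m n (G : 'M[K]_(m, n)) (x : 'cV_m) (y : 'cV_n) : K :=
  (x^T *m G *m y) 0 0.

Definition qform n (G : 'M[K]_n) (x : 'cV_n) : K := bform G x x.

Section BForm.
Variables m n : nat.
Implicit Types (G H : 'M[K]_(m, n)) (x : 'cV[K]_m) (y : 'cV[K]_n).

Lemma bformE G x y : bform G x y = \sum_i \sum_j x i 0 * G i j * y j 0.
Proof.
rewrite /bform !mxE exchange_big /=; apply: eq_bigr => j _.
by rewrite !mxE big_distrl /=; apply: eq_bigr => i _; rewrite !mxE.
Qed.

Lemma bformDm G H x y : bform (G + H) x y = bform G x y + bform H x y.
Proof. by rewrite /bform mulmxDr mulmxDl mxE. Qed.

Lemma bformNm G x y : bform (- G) x y = - bform G x y.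
Proof. by rewrite /bform mulmxN mulNmx mxE. Qed.

Lemma bformZm a G x y : bform (a *: G) x y = a * bform G x y.
Proof. by rewrite /bform -scalemxAr -scalemxAl mxE. Qed.

Lemma bform0m x y : bform (0 : 'M_(m, n)) x y = 0.
Proof. by rewrite /bform mulmx0 mul0mx mxE. Qed.

Lemma bform_summ (I : finType) (F : I -> 'M_(m, n)) x y :
  bform (\sum_i F i) x y = \sum_i bform (F i) x y.
Proof. by rewrite /bform mulmx_sumr mulmx_suml summxE. Qed.

Lemma bformDl G x x' y : bform G (x + x') y = bform G x y + bform G x' y.
Proof. by rewrite /bform linearD /= !mulmxDl mxE. Qed.

Lemma bformDr G x y y' : bform G x (y + y') = bform G x y + bform G x y'.
Proof. by rewrite /bform mulmxDr mxE. Qed.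

Lemma bformZl a G x y : bform G (a *: x) y = a * bform G x y.
Proof. by rewrite /bform linearZ /= -!scalemxAl mxE. Qed.

Lemma bformZr a G x y : bform G x (a *: y) = a * bform G x y.
Proof. by rewrite /bform -scalemxAr mxE. Qed.

Lemma bform_tr G x y : bform G^T y x = bform G x y.
Proof.
have -> : bform G x y = (x^T *m G *m y)^T 0 0 by rewrite [RHS]mxE.
by rewrite !trmx_mul trmxK mulmxA.
Qed.

Lemma bform_delta G i j : bform G (delta_mx i 0) (delta_mx j 0) = G i j.
Proof. by rewrite /bform trmx_delta -rowE -colE [LHS]mxE mxE. Qed.

Lemma bform0r G x : bform G x 0 = 0.
Proof. by rewrite /bform mulmx0 mxE. Qed.

End BForm.

Lemma bformMl m n p (G : 'M[K]_(m, n)) (U : 'M_(m, p)) x y :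
  bform (U^T *m G) x y = bform G (U *m x) y.
Proof. by rewrite /bform trmx_mul !mulmxA. Qed.

Lemma bformMr m n p (G : 'M[K]_(m, n)) (U : 'M_(n, p)) x y :
  bform (G *m U) x y = bform G x (U *m y).
Proof. by rewrite /bform !mulmxA. Qed.

Section QForm.
Variable n : nat.
Implicit Types (G H : 'M[K]_n) (x y : 'cV[K]_n).

Lemma qform_scalar (a : K) x : qform a%:M x = a * qform 1%:M x.
Proof. by rewrite /qform -bformZm scalemx1. Qed.

Lemma qform1E x : qform 1%:M x = \sum_i x i 0 ^+ 2.
Proof.
by rewrite /qform /bform mulmx1 mxE; apply: eq_bigr => i _; rewrite mxE expr2.
Qed.

Lemma qform1_ge0 x : 0 <= qform 1%:M x.
Proof. by rewrite qform1E sumr_ge0 // => i _; rewrite sqr_ge0. Qed.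

Lemma qform1_eq0 x : (qform 1%:M x == 0) = (x == 0).
Proof.
rewrite qform1E psumr_eq0 => [|i _]; last exact: sqr_ge0.
apply/allP/eqP => [x0|-> i _]; last by rewrite mxE expr0n eqxx.
apply/matrixP => i j; rewrite ord1 mxE.
by have /implyP/(_ isT) := x0 i (mem_index_enum _); rewrite sqrf_eq0 => /eqP.
Qed.

Lemma qform1_gt0 x : (0 < qform 1%:M x) = (x != 0).
Proof. by rewrite lt_def qform1_ge0 andbT qform1_eq0. Qed.

(** Each product [x_i x_j] is at most [|x|^2], hence the constant: the sum of the
    absolute values of the entries. The summand [1] only makes it positive. *)
Lemma qform_le_norm G :
  exists2 c, 0 < c & forall x, `|qform G x| <= c * qform 1%:M x.
Proof.
exists (1 + \sum_i \sum_j `|G i j|) => [|x].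
  by apply: ltr_pwDl => //; do 2 ?[apply: sumr_ge0 => ? _].
have xle i : x i 0 ^+ 2 <= qform 1%:M x.
  by rewrite qform1E (bigD1 i) //= lerDl sumr_ge0 // => j _; rewrite sqr_ge0.
rewrite mulrDl mul1r ler_wpDl ?qform1_ge0 // [qform G x]bformE.
rewrite mulr_suml; apply: le_trans (ler_norm_sum _ _ _) _.
apply: ler_sum => i _; rewrite mulr_suml.
apply: le_trans (ler_norm_sum _ _ _) _; apply: ler_sum => j _.
rewrite mulrAC mulrC normrM ler_wpM2l // ler_norml.
have := xle i; have := xle j; have := sqr_ge0 (x i 0 + x j 0).
by have := sqr_ge0 (x i 0 - x j 0) => *; apply/andP; split; lra.
Qed.

Lemma possemidefmxP G : possemidefmx G <-> G^T = G /\ forall x, 0 <= qform G x.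
Proof. by split=> -[/symmxP]. Qed.

Lemma posdefmxP G :
  posdefmx G <-> G^T = G /\ forall x, x != 0 -> 0 < qform G x.
Proof. by split=> -[/symmxP]. Qed.

Lemma posdef_semidef G : posdefmx G -> possemidefmx G.
Proof.
case=> Gs Gp; split=> // x; have [->|x0] := eqVneq x 0; last exact/ltW/Gp.
by rewrite mulmx0 mxE.
Qed.

(** Write [a], [b], [d] for the values of the form at [(x, x)], [(x, y)] and
    [(y, y)]. Nonnegativity at [- b x + a y] reads [0 <= a (a d - b ^ 2)]. If
    [a = 0], nonnegativity at [- (1 + d) x + b y] reads [0 <= - (2 + d) b ^ 2]. *)
Lemma bform_CS G x y : possemidefmx G ->
  bform G x y ^+ 2 <= qform G x * qform G y.
Proof.
move=> /possemidefmxP[Gs Gp].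
have Gxy : bform G y x = bform G x y by rewrite -bform_tr Gs.
have key s t :
    0 <= s ^+ 2 * qform G x + 2 * s * t * bform G x y + t ^+ 2 * qform G y.
  have := Gp (s *: x + t *: y).
  rewrite /qform !(bformDl, bformDr, bformZl, bformZr) Gxy.
  by move=> h; apply: le_trans h _; lra.
have qx := Gp x; have qy := Gp y.
have [qx0|qx0] := eqVneq (qform G x) 0.
  have := key (- (1 + qform G y)) (bform G x y); rewrite qx0.
  by have := mulr_ge0 (sqr_ge0 (bform G x y)) qy; have := sqr_ge0 (bform G x y); lra.
have := key (- bform G x y) (qform G x).
move=> h; have : 0 <= qform G x * (qform G x * qform G y - bform G x y ^+ 2).
  by apply: le_trans h _; lra.
by rewrite pmulr_rge0 ?subr_ge0 // lt_def qx0.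
Qed.

Lemma bform_ker G x y : possemidefmx G -> qform G x = 0 -> bform G x y = 0.
Proof.
move=> Gp qx0; have := bform_CS x y Gp; rewrite qx0 mul0r => h.
by apply/eqP; rewrite -sqrf_eq0 eq_le h sqr_ge0.
Qed.

Lemma posdef_unitmx G : posdefmx G -> G \in unitmx.
Proof.
move=> /posdefmxP[_ Gp]; rewrite -row_free_unit -kermx_eq0.
apply/negPn/negP => /rowV0Pn[v /sub_kermxP vG v0].
have := Gp v^T; rewrite trmx_eq0 => /(_ v0).
by rewrite /qform /bform trmxK vG mul0mx mxE ltxx.
Qed.

Lemma trmx_inv_sym G : G^T = G -> (invmx G)^T = invmx G.
Proof. by rewrite trmx_inv => ->. Qed.

(** Cauchy-Schwarz for [G] at the vectors [G^-1 x] and [x] reads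
    [|x|^4 <= (x^T G^-1 x) (x^T G x)], and [x^T G^-1 x <= c |x|^2] for some [c]. *)
Lemma posdef_ge_scalar G : posdefmx G ->
  exists2 d, 0 < d & forall x, d * qform 1%:M x <= qform G x.
Proof.
move=> Gp; have [c c0 cP] := qform_le_norm (invmx G).
have Gu := posdef_unitmx Gp; have [Gs Gpos] := (posdefmxP G).1 Gp.
exists c^-1 => [|x]; first by rewrite invr_gt0.
have [->|x0] := eqVneq x 0; first by rewrite /qform !bform0r mulr0.
have := bform_CS (invmx G *m x) x (posdef_semidef Gp).
have -> : qform G (invmx G *m x) = qform (invmx G) x.
  rewrite /qform -bformMl -bformMr trmx_inv_sym // -[_ *m _ *m _]mulmxA.
  by rewrite mulmxV // mulmx1.
have -> : bform G (invmx G *m x) x = qform 1%:M x.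
  by rewrite -bformMl trmx_inv_sym // mulVmx.
have := cP x; rewrite ler_norml => /andP[_ cx].
rewrite -qform1_gt0 in x0; move=> h.
have Gx : 0 <= qform G x by exact: (posdef_semidef Gp).2.
rewrite -(ler_pM2l c0) mulrA divff ?gt_eqF // mul1r -(ler_pM2l x0).
rewrite -expr2; apply: le_trans h _.
by apply: le_trans (ler_wpM2r Gx cx) _; rewrite mulrA [X in X * _]mulrC.
Qed.

(** The diagonal of [G] vanishes, so by Cauchy-Schwarz every basis vector is in
    the kernel of [G]. *)
Lemma psd_tr_eq0 G : possemidefmx G -> \tr G = 0 -> G = 0.
Proof.
move=> Gp tr0; have [Gs Gpos] := (possemidefmxP G).1 Gp.
have diag i : 0 <= G i i by rewrite -bform_delta; exact: Gpos.
have d0 i : G i i = 0.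
  by move/eqP: tr0; rewrite psumr_eq0 // => /allP/(_ i (mem_index_enum _))/eqP.
apply/matrixP => i j; rewrite mxE -bform_delta; apply: bform_ker => //.
by rewrite /qform bform_delta.
Qed.

End QForm.
End Forms.

Section PSD.
Variables (K : realType) (n : nat).
Implicit Types G H : 'M[K]_n.

Lemma psd_zero : possemidefmx (0 : 'M[K]_n).
Proof. by apply/possemidefmxP; split=> [|x]; rewrite ?trmx0 // /qform bform0m. Qed.

Lemma psd_tr_ge0 G : possemidefmx G -> 0 <= \tr G.
Proof.
move=> /possemidefmxP[_ Gp]; apply: sumr_ge0 => i _.
by rewrite -bform_delta; apply: Gp.
Qed.

Lemma psdD G H : possemidefmx G -> possemidefmx H -> possemidefmx (G + H).
Proof.
move=> /possemidefmxP[Gs Gp] /possemidefmxP[Hs Hp].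
apply/possemidefmxP; split=> [|x]; first by rewrite trmxD Gs Hs.
by rewrite /qform bformDm addr_ge0 //; [exact: Gp | exact: Hp].
Qed.

Lemma psdZ (a : K) G : 0 <= a -> possemidefmx G -> possemidefmx (a *: G).
Proof.
move=> a0 /possemidefmxP[Gs Gp]; apply/possemidefmxP; split=> [|x].
  by rewrite trmxZ Gs.
by rewrite /qform bformZm mulr_ge0 //; exact: Gp.
Qed.

Lemma psd_congr m (U : 'M_(n, m)) G :
  possemidefmx G -> possemidefmx (U^T *m G *m U).
Proof.
move=> /possemidefmxP[Gs Gp]; apply/possemidefmxP; split=> [|x].
  by rewrite !trmx_mul trmxK Gs mulmxA.
by rewrite /qform -mulmxA bformMl bformMr; exact: Gp.
Qed.

Lemma posdefDr G H : posdefmx G -> possemidefmx H -> posdefmx (G + H).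
Proof.
move=> /posdefmxP[Gs Gp] /possemidefmxP[Hs Hp].
apply/posdefmxP; split=> [|x x0]; first by rewrite trmxD Gs Hs.
by rewrite /qform bformDm ltr_pwDl ?Hp //; exact: Gp.
Qed.

Lemma posdef_scalar (a : K) : 0 < a -> posdefmx (a%:M : 'M[K]_n).
Proof.
move=> a0; apply/posdefmxP; split=> [|x x0]; first by rewrite tr_scalar_mx.
by rewrite qform_scalar mulr_gt0 // qform1_gt0.
Qed.

Lemma posdef_inv G : posdefmx G -> possemidefmx (invmx G).
Proof.
move=> Gp; have Gu := posdef_unitmx Gp; have [Gs _] := (posdefmxP _).1 Gp.
have -> : invmx G = (invmx G)^T *m G *m invmx G.
  by rewrite trmx_inv_sym // -mulmxA mulmxV // mulmx1.
exact/psd_congr/posdef_semidef.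
Qed.

(** The diagonal entries of [G] lie in [0, c], and Cauchy-Schwarz at two basis
    vectors bounds the square of an entry by the product of two of them. *)
Lemma psd_entry_le (c : K) G : possemidefmx G -> possemidefmx (c%:M - G) ->
  forall i j, `|G i j| <= c.
Proof.
move=> Gp /possemidefmxP[_ cG] i j.
have [_ G0] := (possemidefmxP _).1 Gp.
have diag l : 0 <= G l l <= c.
  rewrite -[G l l]bform_delta; apply/andP; split; first exact: G0.
  have := cG (delta_mx l 0).
  by rewrite /qform bformDm bformNm !bform_delta mxE eqxx subr_ge0.
have := bform_CS (delta_mx i 0) (delta_mx j 0) Gp.
rewrite /qform !bform_delta; have := diag i; have := diag j.
by rewrite ler_norml; nra.
Qed.

End PSD.

(** * Coupled Lyapunov operators *)

Section Lyapunov.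
Variable K : realType.

(** Upward closed properties of a real threshold, indexed by a finite type, share
    a threshold: the sum of the absolute values of the individual ones, plus [1]
    for positivity. *)
Lemma fin_uniform_bound (I : finType) (Pr : I -> K -> Prop) :
  (forall i, exists c, forall t, c <= t -> Pr i t) ->
  exists2 c, 0 < c & forall t, c <= t -> forall i, Pr i t.
Proof.
move=> /fin_all_exists[c cP]; exists (1 + \sum_i `|c i|).
  by rewrite ltr_pwDl // sumr_ge0.
move=> t ct i; apply: cP; apply: le_trans ct; apply: le_trans (ler_norm _) _.
by rewrite (bigD1 i) //= addrCA lerDl addr_ge0 // sumr_ge0.
Qed.

Lemma posdef_dominates n (X Y : 'M[K]_n) : posdefmx Y ->
  exists c, forall t, c <= t -> forall x, qform X x <= t * qform Y x.
Proof.
move=> Yp; have [d d0 dP] := posdef_ge_scalar Yp.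
have [c c0 cP] := qform_le_norm X.
exists (c / d) => t ct x.
have := cP x; rewrite ler_norml => /andP[_ /le_trans]; apply.
have Yx : 0 <= qform Y x by exact: (posdef_semidef Yp).2.
apply: le_trans (ler_wpM2r Yx ct); rewrite -mulrA ler_wpM2l ?(ltW c0) //.
by rewrite mulrC ler_pdivlMr // mulrC.
Qed.

Variables (M n : nat) (lam : 'M[K]_M) (r : K).
Hypothesis lam_gen : is_generator lam.

(** The generalized Lyapunov operator attached to the linear dynamics [A], [C],
    the switching rates [lam] and the discount [r]. *)
Definition lyap (A C P : 'I_M -> 'M[K]_n) (i : 'I_M) : 'M[K]_n :=
  r *: P i - (P i *m A i + (A i)^T *m P i + (C i)^T *m P i *m C i
              + \sum_j lam i j *: P j).

Lemma generator_sum_ge0 (f : 'I_M -> K) i :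
  (forall j, 0 <= f j) -> f i = 0 -> 0 <= \sum_j lam i j * f j.
Proof.
move=> f0 fi; rewrite (bigD1 i) //= fi mulr0 add0r sumr_ge0 // => j ji.
by rewrite mulr_ge0 // lam_gen.1 // eq_sym.
Qed.

Section FixedCoefficients.
Variables A C : 'I_M -> 'M[K]_n.
Implicit Types P X : 'I_M -> 'M[K]_n.

Lemma lyapD P X i : lyap A C (fun j => P j + X j) i = lyap A C P i + lyap A C X i.
Proof.
have reorder (V : zmodType) (a a' b b' c c' d d' e e' : V) :
    a + a' - (b + b' + (c + c') + (d + d') + (e + e'))
    = a - (b + c + d + e) + (a' - (b' + c' + d' + e')).
  rewrite [b + b' + _]addrACA [_ + (d + d')]addrACA [_ + (e + e')]addrACA.
  by rewrite opprD addrACA.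
rewrite /lyap scalerDr !(mulmxDl, mulmxDr).
under eq_bigr do rewrite scalerDr.
by rewrite big_split /= reorder.
Qed.

Lemma lyapZ a P i : lyap A C (fun j => a *: P j) i = a *: lyap A C P i.
Proof.
rewrite /lyap !(scalerDr, scalerN, scaler_sumr) -!(scalemxAl, scalemxAr).
rewrite scalerA mulrC -scalerA.
by under eq_bigr do rewrite scalerA mulrC -scalerA.
Qed.

Lemma lyap_tr P i : (lyap A C P i)^T = lyap A C (fun j => (P j)^T) i.
Proof.
rewrite /lyap trmxB !trmxD trmxZ !trmx_mul !trmxK !mulmxA.
rewrite [(A i)^T *m (P i)^T + _]addrC trmx_sum.
by under eq_bigr do rewrite trmxZ.
Qed.

Lemma qform_lyap P i x : (P i)^T = P i ->
  qform (lyap A C P i) x =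
    r * qform (P i) x - (bform (P i) x (A i *m x) *+ 2 + qform (P i) (C i *m x)
                         + \sum_j lam i j * qform (P j) x).
Proof.
move=> Ps; rewrite /qform /lyap -[_ *m _ *m C i]mulmxA.
rewrite !(bformDm, bformNm, bformZm, bform_summ, bformMl) !bformMr.
have -> : bform (P i) (A i *m x) x = bform (P i) x (A i *m x).
  by rewrite -bform_tr Ps.
rewrite mulr2n; congr (_ - (_ + _)).
by apply: eq_bigr => j _; rewrite bformZm.
Qed.

(** The maximum principle behind positivity: [x] minimizes the form of [P i], so
    its first-order terms vanish, and what remains is
    [- (C x)^T (P i) (C x) - sum_j lam i j x^T (P j) x], where the term [j = i] of
    the sum is zero and the rates to [j != i] are nonnegative. *)
Lemma lyap_ker P i x : (forall j, possemidefmx (P j)) -> qform (P i) x = 0 ->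
  qform (lyap A C P i) x <= 0.
Proof.
move=> Pp Px; have [Ps Pi] := (possemidefmxP _).1 (Pp i).
rewrite qform_lyap // Px mulr0 (bform_ker _ (Pp i)) // mul0rn !add0r.
rewrite oppr_le0 addr_ge0 // generator_sum_ge0 // => j.
by have [_] := (possemidefmxP _).1 (Pp j); apply.
Qed.

(** A null vector of [P i] would contradict [lyap_ker]. *)
Lemma lyap_posdef P : (forall i, possemidefmx (P i)) ->
  (forall i, posdefmx (lyap A C P i)) -> forall i, posdefmx (P i).
Proof.
move=> Pp Lp i; have [Ps Pi] := (possemidefmxP _).1 (Pp i).
apply/posdefmxP; split => // x x0; rewrite lt_def Pi andbT.
apply/eqP => /(lyap_ker Pp); rewrite leNgt.
by have [_ ->] := (posdefmxP _).1 (Lp i).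
Qed.

(** Positivity of the Lyapunov operator, with [X] as a certificate of stability.
    Let [m >= 0] be least with [P + m X >= 0]. If [m > 0], then
    [L (P + m X) = L P + m L X] is positive definite, hence so is [P + m X] by
    [lyap_posdef], and [m] can be decreased. *)
Lemma lyap_semidef X P :
  (forall i, posdefmx (X i)) -> (forall i, posdefmx (lyap A C X i)) ->
  (forall i, (P i)^T = P i) -> (forall i, possemidefmx (lyap A C P i)) ->
  forall i, possemidefmx (P i).
Proof.
move=> Xp LX Ps LP.
pose Y t i := P i + t *: X i.
have Ys t i : (Y t i)^T = Y t i.
  by have [Xs _] := (posdefmxP _).1 (Xp i); rewrite trmxD trmxZ Ps Xs.
have qY t i x : qform (Y t i) x = qform (P i) x + t * qform (X i) x.
  by rewrite /qform bformDm bformZm.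
pose T := [set t | 0 <= t /\ forall i, possemidefmx (Y t i)]%classic.
have T0 : (T !=set0)%classic.
  have [c c0 cP] := fin_uniform_bound (fun i => posdef_dominates (- P i) (Xp i)).
  exists c; split=> [|i]; first exact: ltW.
  apply/possemidefmxP; split=> // x; rewrite qY.
  by have := cP c (lexx _) i x; rewrite /qform bformNm; lra.
have Tlb : has_lbound T by exists 0 => t [].
have Tinf : has_inf T by [].
set m := inf T.
have m0 : 0 <= m by apply: lb_le_inf => // t [].
have mT : T m.
  split=> // i; apply/possemidefmxP; split=> // x; rewrite qY.
  have [->|x0] := eqVneq x 0; first by rewrite /qform !bform0r mulr0 addr0.
  have Xx : 0 < qform (X i) x by have [_] := (posdefmxP _).1 (Xp i); apply.
  rewrite addrC -lerBlDr sub0r -ler_pdivrMr //; apply: lb_le_inf => // t [_ Yt].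
  have [_ /(_ x)] := (possemidefmxP _).1 (Yt i).
  by rewrite qY ler_pdivrMr //; lra.
(* The threshold [m] is attained; it remains to see that it is zero. *)
suff m_eq0 : m = 0.
  by move=> i; have [_ /(_ i)] := mT; rewrite /Y m_eq0 scale0r addr0.
apply/eqP; case: (ltgtP m 0) => // [|m_gt0]; first by rewrite ltNge m0.
have Ym : forall i, posdefmx (Y m i).
  apply: lyap_posdef => [|i]; first by case: mT.
  rewrite lyapD lyapZ; have [LPs LPp] := (possemidefmxP _).1 (LP i).
  have [LXs LXp] := (posdefmxP _).1 (LX i).
  apply/posdefmxP; split=> [|x x0]; first by rewrite trmxD trmxZ LPs LXs.
  by rewrite /qform bformDm bformZm ltr_wpDl // ?LPp // mulr_gt0 // LXp.
have [c c0 cP] := fin_uniform_bound (fun i => posdef_dominates (X i) (Ym i)).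
(* [c' >= m^-1] keeps the smaller threshold [m - c'^-1] nonnegative. *)
pose c' := Num.max c m^-1.
have c'0 : 0 < c' by rewrite lt_max c0.
suff : m <= m - c'^-1 by rewrite lerBrDr gerDl leNgt invr_gt0 c'0.
apply: ge_inf => //; split.
  by rewrite subr_ge0 -[leRHS]invrK lef_pV2 ?posrE ?invr_gt0 // le_max lexx orbT.
move=> i; apply/possemidefmxP; split=> // x; rewrite qY mulrBl addrA -qY subr_ge0.
rewrite mulrC ler_pdivrMr // mulrC; apply: cP.
by rewrite le_max lexx.
Qed.

Lemma lyap_inj X P :
  (forall i, posdefmx (X i)) -> (forall i, posdefmx (lyap A C X i)) ->
  (forall i, (P i)^T = P i) -> (forall i, lyap A C P i = 0) ->
  forall i, P i = 0.
Proof.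
move=> Xp LX Ps LP i.
have Pp j : possemidefmx (P j).
  by apply: (lyap_semidef Xp LX) => // l; rewrite LP; exact: psd_zero.
have Np : possemidefmx (-1 *: P i).
  apply: (lyap_semidef Xp LX (P := fun j => -1 *: P j)) => l.
    by rewrite trmxZ Ps.
  by rewrite lyapZ LP scaler0; exact: psd_zero.
apply: psd_tr_eq0 => //; apply/eqP; rewrite eq_le.
by rewrite psd_tr_ge0 // andbT -oppr_ge0 -mulN1r -linearZ psd_tr_ge0.
Qed.

(** Positivity gives injectivity of [L] on symmetric families only. This
    endomorphism of the whole space of families acts as [L] on (twice) the
    symmetric part and as the identity on (twice) the skew part, so it is
    injective as soon as [L] is injective on symmetric families. *)
Definition lyap_sym_skew (P : {ffun 'I_M -> 'M[K]_n}) : {ffun 'I_M -> 'M[K]_n} :=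
  [ffun i => lyap A C (fun j => P j + (P j)^T) i + (P i - (P i)^T)].

Fact lyap_sym_skew_linear : linear lyap_sym_skew.
Proof.
move=> a P P'; apply/ffunP => i; rewrite !ffunE.
rewrite scalerDr [RHS]addrACA; congr (_ + _).
  rewrite -lyapZ -lyapD; congr (lyap A C _ i); apply/funext => j.
  by rewrite !ffunE trmxD trmxZ scalerDr addrACA.
by rewrite trmxD trmxZ scalerBr opprD addrACA.
Qed.

HB.instance Definition _ := GRing.isLinear.Build K {ffun 'I_M -> 'M[K]_n}
  {ffun 'I_M -> 'M[K]_n} *:%R lyap_sym_skew lyap_sym_skew_linear.

(** An injective endomorphism of a finite-dimensional space is surjective. Applied
    to [lyap_sym_skew], it yields a preimage of [N] whose skew part vanishes
    because [N] is symmetric. *)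
Lemma lyap_surj X N :
  (forall i, posdefmx (X i)) -> (forall i, posdefmx (lyap A C X i)) ->
  (forall i, (N i)^T = N i) ->
  exists2 P : 'I_M -> 'M[K]_n,
    forall i, (P i)^T = P i & forall i, lyap A C P i = N i.
Proof.
move=> Xp LX Ns.
pose Lsym (P : 'I_M -> 'M[K]_n) := lyap A C (fun j => P j + (P j)^T).
have Lsym_tr P i : (Lsym P i)^T = Lsym P i.
  rewrite /Lsym lyap_tr; congr (lyap A C _ i); apply/funext => j.
  by rewrite trmxD trmxK addrC.
(* A symmetric value has a preimage without skew part. *)
have decomp (P : {ffun 'I_M -> 'M[K]_n}) (N' : 'I_M -> 'M[K]_n) :
    (forall i, (N' i)^T = N' i) -> (forall i, lyap_sym_skew P i = N' i) ->
    (forall i, (P i)^T = P i) /\ (forall i, Lsym P i = N' i).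
  move=> N's TP.
  have Ps i : (P i)^T = P i.
    have := N's i; rewrite -TP ffunE trmxD Lsym_tr trmxB trmxK => /addrI h.
    by apply/matrixP => a b; move/matrixP/(_ a b): h; rewrite !mxE; lra.
  by split=> // i; rewrite -TP ffunE Ps subrr addr0.
have inj : lker (linfun lyap_sym_skew) == 0%VS.
  rewrite -subv0; apply/subvP => P; rewrite memv_ker lfunE memv0 => /eqP TP0.
  have [Ps LP] : (forall i, (P i)^T = P i) /\ (forall i, Lsym P i = 0).
    by apply: (decomp _ (fun=> 0)) => i; rewrite ?trmx0 // TP0 ffunE.
  apply/eqP/ffunP => i; rewrite ffunE.
  have := lyap_inj Xp LX (P := fun j => P j + (P j)^T) _ LP.
  move=> /(_ _ i); rewrite Ps => h.
  have {}h : P i + P i = 0 by apply: h => j; rewrite trmxD trmxK addrC.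
  by apply/matrixP => a b; move/matrixP/(_ a b): h; rewrite !mxE; lra.
pose P := ((linfun lyap_sym_skew)^-1)%VF [ffun i => N i].
have TP : lyap_sym_skew P = [ffun i => N i].
  by rewrite -[LHS](lfunE lyap_sym_skew) /P lker0_lfunVK.
have [|Ps LP] := decomp P N Ns; first by move=> i; rewrite TP ffunE.
exists (fun j => P j + (P j)^T) => // i.
by rewrite trmxD trmxK addrC.
Qed.

End FixedCoefficients.
End Lyapunov.

(** * Continuity and compactness for families of matrices *)

Section SquaredNorm.
Variables (K : realType) (m n : nat).
Implicit Types G : 'M[K]_(m, n).

Definition sqnorm G : K := \sum_i \sum_j G i j ^+ 2.

Lemma sqnorm_ge0 G : 0 <= sqnorm G.
Proof. by apply: sumr_ge0 => i _; apply: sumr_ge0 => j _; exact: sqr_ge0. Qed.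

Lemma sqnorm_eq0 G : sqnorm G = 0 -> G = 0.
Proof.
move=> /eqP; rewrite psumr_eq0 => [/allP G0|i _]; last first.
  by apply: sumr_ge0 => j _; exact: sqr_ge0.
apply/matrixP => i j; rewrite mxE; apply/eqP; rewrite -sqrf_eq0.
have := G0 i (mem_index_enum _); rewrite /= psumr_eq0 => [/allP|b _].
  exact: (fun h => h j (mem_index_enum _)).
exact: sqr_ge0.
Qed.

Lemma sqnormZ a G : sqnorm (a *: G) = a ^+ 2 * sqnorm G.
Proof.
rewrite /sqnorm mulr_sumr; apply: eq_bigr => i _; rewrite mulr_sumr.
by apply: eq_bigr => j _; rewrite mxE exprMn.
Qed.

End SquaredNorm.

Section Continuity.
Variables (K : realType) (T : topologicalType).

Lemma continuous_sum (I : finType) (F : I -> T -> K) :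
  (forall i, continuous (F i)) -> continuous (fun t => \sum_i F i t).
Proof. by move=> cF; apply: continuous_big => //; exact: add_continuous. Qed.

Lemma continuous_prod (I : finType) (F : I -> T -> K) :
  (forall i, continuous (F i)) -> continuous (fun t => \prod_i F i t).
Proof. by move=> cF; apply: continuous_big => //; exact: mul_continuous. Qed.

Lemma continuous_oppr (a : T -> K) :
  continuous a -> continuous (fun t => - a t).
Proof. by move=> ca t; apply: cvgN; exact: ca. Qed.

Lemma continuous_sqr (a : T -> K) :
  continuous a -> continuous (fun t => a t ^+ 2).
Proof.
by move=> ca t; under eq_fun do rewrite expr2; apply: cvgM; exact: ca.
Qed.

(** Entrywise continuity: it turns the continuity of polynomial expressions in
    matrices into that of sums and products of reals. *)
Definition mxcontinuous m n (F : T -> 'M[K]_(m, n)) :=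
  forall i j, continuous (fun t => F t i j).

Section Operations.
Variables m n : nat.
Implicit Types F G : T -> 'M[K]_(m, n).

Lemma mxcontinuous_cst (G : 'M[K]_(m, n)) : mxcontinuous (fun=> G).
Proof. by move=> i j; exact: cst_continuous. Qed.

Lemma mxcontinuousD F G :
  mxcontinuous F -> mxcontinuous G -> mxcontinuous (fun t => F t + G t).
Proof.
move=> cF cG i j t; under eq_fun do rewrite mxE.
by apply: cvgD; [exact: cF | exact: cG].
Qed.

Lemma mxcontinuousN F : mxcontinuous F -> mxcontinuous (fun t => - F t).
Proof. by move=> cF i j t; under eq_fun do rewrite mxE; apply: cvgN; exact: cF. Qed.

Lemma mxcontinuousZ (a : T -> K) F :
  continuous a -> mxcontinuous F -> mxcontinuous (fun t => a t *: F t).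
Proof.
move=> ca cF i j t; under eq_fun do rewrite mxE.
by apply: cvgM; [exact: ca | exact: cF].
Qed.

Lemma mxcontinuous_tr F : mxcontinuous F -> mxcontinuous (fun t => (F t)^T).
Proof. by move=> cF i j; under eq_fun do rewrite mxE; exact: cF. Qed.

Lemma mxcontinuous_sum (I : finType) (F : I -> T -> 'M[K]_(m, n)) :
  (forall l, mxcontinuous (F l)) -> mxcontinuous (fun t => \sum_l F l t).
Proof.
move=> cF i j; under eq_fun do rewrite summxE.
by apply: continuous_sum => l; exact: cF.
Qed.

End Operations.

Lemma mxcontinuousM m n p (F : T -> 'M[K]_(m, n)) (G : T -> 'M[K]_(n, p)) :
  mxcontinuous F -> mxcontinuous G -> mxcontinuous (fun t => F t *m G t).
Proof.
move=> cF cG i j; under eq_fun do rewrite mxE.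
apply: continuous_sum => l t.
by apply: cvgM; [exact: cF | exact: cG].
Qed.

Lemma continuous_det n (F : T -> 'M[K]_n) :
  mxcontinuous F -> continuous (fun t => \det (F t)).
Proof.
move=> cF; apply: continuous_sum => s t.
by apply: cvgM; [exact: cvg_cst | apply: continuous_prod => i; exact: cF].
Qed.

(** The adjugate stands in for the inverse, which is discontinuous where the
    determinant vanishes. *)
Lemma mxcontinuous_adj n (F : T -> 'M[K]_n) :
  mxcontinuous F -> mxcontinuous (fun t => \adj (F t)).
Proof.
move=> cF i j t; under eq_fun do rewrite mxE.
apply: cvgM; first exact: cvg_cst.
apply: continuous_det => a b; under eq_fun do rewrite !mxE.
exact: cF.
Qed.

Lemma continuous_bform m n (F : T -> 'M[K]_(m, n)) x y :
  mxcontinuous F -> continuous (fun t => bform (F t) x y).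
Proof.
move=> cF; have cst p q (G : 'M[K]_(p, q)) : mxcontinuous (fun=> G).
  exact: mxcontinuous_cst.
exact: (mxcontinuousM (mxcontinuousM (cst _ _ x^T) cF) (cst _ _ y)).
Qed.

Lemma continuous_sqnorm m n (F : T -> 'M[K]_(m, n)) :
  mxcontinuous F -> continuous (fun t => sqnorm (F t)).
Proof.
move=> cF; apply: continuous_sum => i; apply: continuous_sum => j.
exact/continuous_sqr/cF.
Qed.

Lemma closed_ge0 (g : T -> K) : continuous g -> closed [set t | 0 <= g t]%classic.
Proof.
move=> cg; apply: (@preimage_closed _ _ g [set x | 0 <= x]%classic).
  by move=> t _; exact: cg.
exact: closed_ge.
Qed.

Lemma closed_forall (I : Type) (E : I -> T -> Prop) :
  (forall i, closed [set t | E i t]%classic) ->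
  closed [set t | forall i, E i t]%classic.
Proof.
move=> cE t clt i; apply: cE => U /clt[s [Es Us]].
by exists s; split=> //; exact: Es.
Qed.

Lemma closed_and (E E' : T -> Prop) :
  closed [set t | E t]%classic -> closed [set t | E' t]%classic ->
  closed [set t | E t /\ E' t]%classic.
Proof. exact: closedI. Qed.

Lemma closed_possemidef n (F : T -> 'M[K]_n) :
  mxcontinuous F -> closed [set t | possemidefmx (F t)]%classic.
Proof.
move=> cF.
rewrite (_ : mkset _ = [set t |
   (forall i j, 0 <= (F t)^T i j - F t i j) /\
    forall x, 0 <= qform (F t) x]%classic).
  apply: closed_and; apply: closed_forall => i.
    apply: closed_forall => j; apply: closed_ge0 => t.
    by apply: cvgB; [exact: mxcontinuous_tr|exact: cF].
  by apply: closed_ge0; exact: continuous_bform.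
apply/seteqP; split=> t /=.
  by move/possemidefmxP => [Fs Fp]; split=> // i j; rewrite Fs subrr.
move=> [Fs Fp]; apply/possemidefmxP; split=> //; apply/matrixP => i j.
rewrite mxE; have := Fs j i; have := Fs i j; rewrite !mxE !subr_ge0 => le1 le2.
by apply: le_anti; rewrite le1 le2.
Qed.

End Continuity.

Section Families.
Variables (K : realType) (M n : nat).

(* Families are encoded by their coordinates to make Tychonoff's theorem
   available: bounded sets lie in a product of segments. *)
Let coords := prod_topology (fun _ : 'I_M * 'I_n * 'I_n => K).

Definition family_of (f : coords) (i : 'I_M) : 'M[K]_n := \matrix_(a, b) f (i, a, b).

Definition coords_of (P : 'I_M -> 'M[K]_n) : coords := fun l => P l.1.1 l.1.2 l.2.

Lemma coords_ofK P : family_of (coords_of P) = P.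
Proof. by apply/funext => i; apply/matrixP => a b; rewrite mxE. Qed.

Lemma mxcontinuous_family i : mxcontinuous (fun f => family_of f i).
Proof.
move=> a b.
have -> : (fun f : coords => family_of f i a b) = (fun f => f (i, a, b)).
  by apply/funext => f; rewrite mxE.
exact: (@proj_continuous _ (fun=> K) (i, a, b)).
Qed.

Lemma family_min (c : K) (E : ('I_M -> 'M[K]_n) -> Prop)
    (g : ('I_M -> 'M[K]_n) -> K) :
  closed [set f | E (family_of f)]%classic ->
  (forall P, E P -> forall i a b, `|P i a b| <= c) ->
  continuous (fun f => g (family_of f)) ->
  (exists P, E P) ->
  exists2 P, E P & forall P', E P' -> g P <= g P'.
Proof.
move=> clE Ec cg [P0 EP0].
have cptE : compact [set f : coords | E (family_of f)]%classic.
  apply: (@subclosed_compact _ _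
      [set f : coords | forall l, `[- c, c]%classic (f l)]%classic) => //.
    exact: (@tychonoff _ (fun=> K) _ (fun=> @segment_compact _ (- c) c)).
  move=> f /= Ef [[i a] b]; have := Ec _ Ef i a b.
  by rewrite mxE ler_norml /= in_itv.
have [|f] := @compact_EVT_min coords K _ _ _ cptE (continuous_subspaceT cg).
  by exists (coords_of P0) => /=; rewrite coords_ofK.
rewrite inE /= => Ef fmin; exists (family_of f) => // P' EP'.
by rewrite -(coords_ofK P'); apply: fmin; rewrite inE /= coords_ofK.
Qed.

End Families.

(** * The Riccati defect and feedback *)

(** Proves matrix identities that are linear in the matrix products they contain:
    the products become atoms, and the identity is checked entry by entry. *)
Ltac mx_ring :=
  repeat match goal with
  | |- context [@mulmx ?R ?m ?n ?p ?a ?b] =>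
      move: (@mulmx R m n p a b) => ? end;
  apply/matrixP => ? ?; rewrite !mxE;
  repeat match goal with
  | |- context [@fun_of_matrix ?R ?m ?n ?a ?i ?j] =>
      move: (@fun_of_matrix R m n a i j) => ? end;
  ring.

Section Riccati.
Variables (K : realType) (M n k : nat) (lam : 'M[K]_M) (r : K).
Variables (A C : 'I_M -> 'M[K]_n) (B D : 'I_M -> 'M[K]_(n, k)).
Variable Rw : 'I_M -> 'M[K]_k.
Hypothesis Rw_gt0 : forall i, posdefmx (Rw i).
Implicit Types (P Q : 'I_M -> 'M[K]_n) (Th : 'I_M -> 'M[K]_(k, n)).

Local Notation S := (riccati_S C B D).
Local Notation Rt := (riccati_Rtilde D Rw).

(** Under the feedback [u = Th x], the dynamics [A x + B u], [C x + D u] and the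
    cost [x^T Q x + u^T R u] become linear and quadratic in [x] alone, with these
    coefficients. *)
Definition closed_drift Th i : 'M[K]_n := A i + B i *m Th i.
Definition closed_diffusion Th i : 'M[K]_n := C i + D i *m Th i.
Definition running_cost Q Th i : 'M[K]_n := Q i + (Th i)^T *m Rw i *m Th i.

(** The feedback at which the square in [complete_square] vanishes. *)
Definition gain P i : 'M[K]_(k, n) := - (invmx (Rt P i) *m S P i).

Definition riccati_defect Q P i : 'M[K]_n :=
  lyap lam r A C P i + (S P i)^T *m invmx (Rt P i) *m S P i - Q i.

Lemma Rtilde_posdef P i : possemidefmx (P i) -> posdefmx (Rt P i).
Proof. by move=> Pp; apply: posdefDr => //; exact: psd_congr. Qed.

Lemma solves_defect Q P : (forall i, possemidefmx (P i)) ->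
  (forall i, riccati_defect Q P i = 0) ->
  solves_coupled_riccati lam r A C B D Q Rw P.
Proof.
move=> Pp dP i; split; last exact: Rtilde_posdef.
apply/eqP; rewrite -subr_eq0 -[X in _ == X](dP i) /riccati_defect /lyap; apply/eqP.
move: (\sum_j _) => Z; mx_ring.
Qed.

(** Two uses: at [Th = gain P] the square vanishes and the Lyapunov operator of
    the feedback is known on [P]; and for an arbitrary [Th], a solution of the
    Lyapunov equation [L_Th P = running_cost Q Th] has a square, hence a
    nonnegative matrix, as its defect. *)
Lemma complete_square Q P Th i :
  possemidefmx (P i) ->
  lyap lam r (closed_drift Th) (closed_diffusion Th) P i
  = riccati_defect Q P i + running_cost Q Th i
    - (Th i - gain P i)^T *m Rt P i *m (Th i - gain P i).
Proof.
move=> Pp; have Rp := Rtilde_posdef Pp; have Ru := posdef_unitmx Rp.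
have [Rs _] := (posdefmxP _).1 Rp; have [Ps _] := (possemidefmxP _).1 Pp.
have [Rws _] := (posdefmxP _).1 (Rw_gt0 i).
have -> : (Th i - gain P i)^T *m Rt P i *m (Th i - gain P i)
  = (Th i)^T *m Rt P i *m Th i + (Th i)^T *m S P i + (S P i)^T *m Th i
    + (S P i)^T *m invmx (Rt P i) *m S P i.
  rewrite /gain opprK; move: (S P i) (Rt P i) Ru Rs => S' R' Ru Rs.
  rewrite trmxD trmx_mul trmx_inv_sym // mulmxDl mulmxKV //.
  rewrite !mulmxDr !mulmxDl !mulmxA mulmxK //; mx_ring.
rewrite /riccati_defect; move: ((S P i)^T *m invmx _ *m _) => Z.
rewrite /lyap /closed_drift /closed_diffusion /running_cost.
rewrite /riccati_S /riccati_Rtilde !trmxD !trmx_mul !trmxK Ps.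
rewrite !(mulmxDl, mulmxDr) !mulmxA.
move: (\sum_j _) => Y; mx_ring.
Qed.

End Riccati.

(** * Existence of solutions *)

Section Existence.
Variables (K : realType) (M n k : nat) (lam : 'M[K]_M) (r : K).
Variables (A C : 'I_M -> 'M[K]_n) (B D : 'I_M -> 'M[K]_(n, k)).
Variable Rw : 'I_M -> 'M[K]_k.
Hypothesis lam_gen : is_generator lam.
Hypothesis Rw_gt0 : forall i, posdefmx (Rw i).
Implicit Types (P Q : 'I_M -> 'M[K]_n).

Local Notation riccati_defect := (riccati_defect lam r A C B D Rw).
Local Notation S := (riccati_S C B D).
Local Notation Rt := (riccati_Rtilde D Rw).

Definition between0 (c : K) P :=
  forall i, possemidefmx (P i) /\ possemidefmx (c%:M - P i).

(** The defect times [det (Rt P i) ^ 2], written with the adjugate in place of the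
    inverse so as to be a polynomial, hence continuous, function of [P]. The square
    keeps the factor positive on [P >= 0]. *)
Definition cleared_defect Q P i : 'M[K]_n :=
  \det (Rt P i) ^+ 2 *: (lyap lam r A C P i - Q i)
  + \det (Rt P i) *: ((S P i)^T *m \adj (Rt P i) *m S P i).

Lemma cleared_defectE Q P i : possemidefmx (P i) ->
  cleared_defect Q P i = \det (Rt P i) ^+ 2 *: riccati_defect Q P i.
Proof.
move=> Pp; have Ru := posdef_unitmx (Rtilde_posdef D Rw_gt0 Pp).
rewrite /cleared_defect /riccati_defect /invmx Ru -scalemxAr -scalemxAl.
rewrite [in RHS]addrAC [RHS]scalerDr [in RHS]scalerA expr2.
rewrite -[_ * _ * _^-1]mulrA divff ?mulr1 //.
by rewrite -unitfE -unitmxE.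
Qed.

Lemma det_sqr_gt0 P i : possemidefmx (P i) -> 0 < \det (Rt P i) ^+ 2.
Proof.
move=> Pp; have := posdef_unitmx (Rtilde_posdef D Rw_gt0 Pp).
by rewrite unitmxE unitfE exprn_even_gt0.
Qed.

Lemma psd_cleared Q P i : possemidefmx (P i) ->
  possemidefmx (cleared_defect Q P i) <-> possemidefmx (riccati_defect Q P i).
Proof.
move=> Pp; rewrite cleared_defectE //; have d0 := det_sqr_gt0 Pp.
split; last exact/psdZ/ltW.
move=> /(@psdZ _ _ (\det (Rt P i) ^+ 2)^-1); rewrite invr_ge0 ltW // => /(_ isT).
by rewrite scalerA mulVf ?scale1r // gt_eqF.
Qed.

Lemma mxcontinuous_Rtilde i : mxcontinuous (fun f => Rt (family_of f) i).
Proof.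
apply: mxcontinuousD; first exact: mxcontinuous_cst.
apply: mxcontinuousM; last exact: mxcontinuous_cst.
by apply: mxcontinuousM; [exact: mxcontinuous_cst | exact: mxcontinuous_family].
Qed.

Arguments mxcontinuous_Rtilde : clear implicits.

Lemma continuous_det_sqr i : continuous (fun f => \det (Rt (family_of f) i) ^+ 2).
Proof.
exact/continuous_sqr/continuous_det/mxcontinuous_Rtilde.
Qed.

Lemma mxcontinuous_cleared Q i :
  mxcontinuous (fun f => cleared_defect Q (family_of f) i).
Proof.
have cst p q (G : 'M[K]_(p, q)) : mxcontinuous (fun=> G).
  exact: mxcontinuous_cst.
have cP j := @mxcontinuous_family K M n j.
have cS : mxcontinuous (fun f => S (family_of f) i).
  apply: mxcontinuousD; last (apply: mxcontinuousM; last exact: cst).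
  - by apply: mxcontinuousM; [exact: cst | exact: cP].
  - by apply: mxcontinuousM; [exact: cst | exact: cP].
apply: mxcontinuousD.
  apply: mxcontinuousZ; first exact: continuous_det_sqr.
  apply: mxcontinuousD; last exact: cst.
  apply: mxcontinuousD.
    by apply: mxcontinuousZ => [|]; [exact: cst_continuous | exact: cP].
  apply: mxcontinuousN; apply: mxcontinuousD.
    apply: mxcontinuousD; first apply: mxcontinuousD.
    - by apply: mxcontinuousM; [exact: cP | exact: cst].
    - by apply: mxcontinuousM; [exact: cst | exact: cP].
    - apply: mxcontinuousM; last exact: cst.
      by apply: mxcontinuousM; [exact: cst | exact: cP].
  apply: mxcontinuous_sum => j.
  by apply: mxcontinuousZ; [exact: cst_continuous | exact: cP].
apply: mxcontinuousZ; first exact/continuous_det/mxcontinuous_Rtilde.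
apply: mxcontinuousM => //; apply: mxcontinuousM.
  exact: mxcontinuous_tr.
exact/mxcontinuous_adj/mxcontinuous_Rtilde.
Qed.

Lemma closed_between c : closed [set f | between0 c (@family_of K M n f)]%classic.
Proof.
apply: closed_forall => i; apply: closed_and; apply: closed_possemidef.
  exact: mxcontinuous_family.
apply: mxcontinuousD; first exact: mxcontinuous_cst.
exact/mxcontinuousN/mxcontinuous_family.
Qed.

Lemma between_entry c P : between0 c P -> forall i a b, `|P i a b| <= c.
Proof. by move=> Pc i a b; have [P0 cP] := Pc i; apply: psd_entry_le. Qed.

(** Minimal supersolutions are solutions. Definiteness of [Q] is what makes the
    closed-loop operator at a supersolution [P] stable, with [P] itself as the
    certificate. *)
Lemma riccati_strict Q c : 0 <= c -> (forall i, posdefmx (Q i)) ->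
  (forall i, possemidefmx (lyap lam r A C (fun=> c%:M) i - Q i)) ->
  exists2 P, between0 c P & forall i, riccati_defect Q P i = 0.
Proof.
move=> c0 Qp cQ.
pose E P := between0 c P /\ forall i, possemidefmx (cleared_defect Q P i).
pose g P := \sum_(i : 'I_M) \tr (P i).
have cc : possemidefmx (c%:M : 'M[K]_n).
  by rewrite -scalemx1; apply: psdZ => //; exact/posdef_semidef/posdef_scalar.
have [|P|||P [Pc dP] Pmin] := @family_min K M n c E g.
- apply: closed_and; first exact: closed_between.
  apply: closed_forall => i.
  exact/closed_possemidef/mxcontinuous_cleared.
- by case=> Pc _; apply: between_entry.
- apply: continuous_sum => i; apply: continuous_sum => a.
  exact: mxcontinuous_family.
- exists (fun=> c%:M); split=> i.
    by split=> //; rewrite subrr; exact: psd_zero.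
  apply/(psd_cleared Q (P := fun=> c%:M) (i := i) cc).
  rewrite /riccati_defect addrAC; apply: psdD => //.
  by apply: psd_congr; apply/posdef_inv/Rtilde_posdef.
have Pp i : possemidefmx (P i) by case: (Pc i).
have {}dP i : possemidefmx (riccati_defect Q P i).
  exact: (psd_cleared Q (Pp i)).1 (dP i).
(* The Newton step [P'] from the minimizer [P]. *)
pose Th := gain C B D Rw P.
pose A' := closed_drift A B Th; pose C' := closed_diffusion C D Th.
pose N := running_cost Rw Q Th.
have Np i : posdefmx (N i).
  by apply: posdefDr => //; apply/psd_congr/posdef_semidef.
have LP i : lyap lam r A' C' P i = riccati_defect Q P i + N i.
  by rewrite (complete_square _ _ _ _ _ _ Rw_gt0 Q) // subrr trmx0 !mul0mx subr0.
have LPp i : posdefmx (lyap lam r A' C' P i).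
  by rewrite LP addrC; exact: posdefDr.
have Ppos := lyap_posdef lam_gen Pp LPp.
have Ns i : (N i)^T = N i by case: ((posdefmxP _).1 (Np i)).
have [P' P's LP'] := lyap_surj lam_gen Ppos LPp Ns.
have P'p : forall i, possemidefmx (P' i).
  apply: (lyap_semidef lam_gen Ppos LPp P's) => i.
  by rewrite LP'; exact: posdef_semidef.
have PP' i : possemidefmx (P i - P' i).
  rewrite -[- P' i]scaleN1r.
  apply: (lyap_semidef lam_gen Ppos LPp (P := fun j => P j + (-1) *: P' j)) => j.
    by rewrite trmxD trmxZ P's; have [-> _] := (possemidefmxP _).1 (Pp j).
  by rewrite lyapD lyapZ LP LP' scaleN1r addrK.
have EP' : E P'.
  split=> i.
    split=> //; have [_ cP] := Pc i.
    by have := psdD cP (PP' i); rewrite addrA subrK.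
  apply/(psd_cleared Q (P'p i)).
  have := complete_square lam r A C B D Rw_gt0 Q Th (P'p i).
  rewrite -/A' -/C' LP' addrAC -[LHS]add0r => /addIr/esym/subr0_eq ->.
  exact/psd_congr/posdef_semidef/Rtilde_posdef.
have eqP i : P i = P' i.
  apply/eqP; rewrite -subr_eq0; apply/eqP/psd_tr_eq0 => //.
  have : \sum_i \tr (P i - P' i) <= 0.
    under eq_bigr do rewrite raddfB.
    by rewrite sumrB subr_le0; exact: Pmin.
  move=> le0; have /eqP : \sum_i \tr (P i - P' i) = 0.
    by apply: le_anti; rewrite le0 sumr_ge0 // => j _; exact: psd_tr_ge0.
  rewrite psumr_eq0 => [/allP/(_ i (mem_index_enum _))/eqP //|j _].
  exact: psd_tr_ge0.
exists P => // i.
have /funext PP : P =1 P' by [].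
by have := LP i; rewrite {1}PP LP' => /esym/(canRL (addrK _)); rewrite subrr.
Qed.

(** Passage to the limit from [Q + e I] to [Q], as the vanishing of a minimum: the
    squared norm of the cleared defect takes at the solution for [Q + e I] a value
    of order [e ^ 2]. The maximum of [h] makes this uniform in [e]. *)
Lemma riccati_semidefinite Q c : 0 <= c -> (forall i, possemidefmx (Q i)) ->
  (forall i, possemidefmx (lyap lam r A C (fun=> c%:M) i - (Q i + 1%:M))) ->
  exists2 P, between0 c P & forall i, riccati_defect Q P i = 0.
Proof.
move=> c0 Qp cQ.
have approx e : 0 < e <= 1 ->
    exists2 P, between0 c P & forall i, riccati_defect Q P i = e%:M.
  move=> /andP[e0 e1].
  have [i|i|P Pc dP] := @riccati_strict (fun i => Q i + e%:M) c c0.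
  - by rewrite addrC; apply: posdefDr => //; exact: posdef_scalar.
  - have -> : lyap lam r A C (fun=> c%:M) i - (Q i + e%:M)
        = lyap lam r A C (fun=> c%:M) i - (Q i + 1%:M) + (1 - e) *: 1%:M.
      by rewrite scalerBl scale1r scalemx1 !opprD !addrA subrK.
    apply: psdD => //; apply: psdZ; first by rewrite subr_ge0.
    exact/posdef_semidef/posdef_scalar.
  - exists P => // i; have := dP i.
    by rewrite /riccati_defect opprD addrA => /eqP; rewrite subr_eq0 => /eqP.
pose f P := \sum_i sqnorm (cleared_defect Q P i).
pose h P := \sum_i sqnorm (\det (Rt P i) ^+ 2 *: (1%:M : 'M[K]_n)).
have [||||P Pc Pmin] := @family_min K M n c (between0 c) f.
- exact: closed_between.
- exact: between_entry.
- by apply: continuous_sum => i; exact/continuous_sqnorm/mxcontinuous_cleared.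
- by have [|P Pc _] := approx 1; [rewrite ltr01 lexx | exists P].
have [||||P1 P1c P1max] := @family_min K M n c (between0 c) (fun P => - h P).
- exact: closed_between.
- exact: between_entry.
- apply: continuous_oppr; apply: continuous_sum => i; apply: continuous_sqnorm.
  by apply: mxcontinuousZ; [exact: continuous_det_sqr | exact: mxcontinuous_cst].
- by exists P.
have fle e : 0 < e <= 1 -> f P <= e ^+ 2 * h P1.
  move=> e01; have [Pe Pec dPe] := approx e e01; apply: le_trans (Pmin _ Pec) _.
  have -> : f Pe = e ^+ 2 * h Pe.
    rewrite /f /h mulr_sumr; apply: eq_bigr => i _.
    rewrite cleared_defectE; last by case: (Pec i).
    by rewrite dPe -sqnormZ -[e%:M]scalemx1 !scalerA mulrC.
  by rewrite ler_wpM2l ?sqr_ge0 // -lerN2; exact: P1max.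
have f_ge0 : 0 <= f P by apply: sumr_ge0 => i _; exact: sqnorm_ge0.
have f0 : f P = 0.
  apply/eqP; case: (ltgtP (f P) 0) => // [|fP]; first by rewrite ltNge f_ge0.
  have fh : f P <= h P1.
    rewrite -[h P1]mul1r -[X in X * _](expr1n _ 2); apply: fle.
    by rewrite ltr01 lexx.
  have h0 : 0 < h P1 by apply: lt_le_trans fP fh.
  (* At this [e], the bound [e ^ 2 * h P1] is at most a quarter of [f P]. *)
  have e0 : 0 < f P / (h P1 * 2) by rewrite divr_gt0 // mulr_gt0.
  have e1 : f P / (h P1 * 2) <= 1 / 2.
    by rewrite ler_pdivrMr ?mulr_gt0 //; lra.
  have e01 : 0 < f P / (h P1 * 2) <= 1 by rewrite e0 (le_trans e1) //; lra.
  have := fle _ e01.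
  have -> : (f P / (h P1 * 2)) ^+ 2 * h P1 = f P / (h P1 * 2) * (f P / 2).
    by field; rewrite gt_eqF.
  by nra.
exists P => // i; have [Pp _] := Pc i.
have : cleared_defect Q P i = 0.
  apply: sqnorm_eq0; move/eqP: f0.
  rewrite psumr_eq0 => [|j _]; last exact: sqnorm_ge0.
  by move=> /allP/(_ i (mem_index_enum _))/eqP.
move=> /eqP; rewrite cleared_defectE // scaler_eq0 gt_eqF ?det_sqr_gt0 //=.
by move/eqP.
Qed.

(** On the constant family [c I] the switching terms cancel and [L] multiplies
    [r - (A + A^T + C^T C)] by [c]. *)
Lemma scalar_supersolution Q :
  (forall i, posdefmx (r%:M - (A i + (A i)^T + (C i)^T *m C i))) ->
  (forall i, (Q i)^T = Q i) ->
  exists2 c, 0 <= c & forall i, possemidefmx (lyap lam r A C (fun=> c%:M) i - Q i).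
Proof.
move=> hC Qs.
have [c c0 cP] := fin_uniform_bound (fun i => posdef_dominates (Q i) (hC i)).
exists c => [|i]; first exact: ltW.
have [hs _] := (posdefmxP _).1 (hC i).
have -> : lyap lam r A C (fun=> c%:M) i
    = c *: (r%:M - (A i + (A i)^T + (C i)^T *m C i)).
  rewrite /lyap -scaler_suml lam_gen.2 scale0r addr0 mul_scalar_mx !mul_mx_scalar.
  by rewrite -scalemxAl scalerBr !scalerDr !scale_scalar_mx mulrC.
apply/possemidefmxP; split=> [|x]; first by rewrite trmxB trmxZ hs Qs.
by rewrite /qform bformDm bformZm bformNm subr_ge0; exact: cP.
Qed.

End Existence.

Theorem theorem5p2 (K : realType) (M n k : nat)
  (lam : 'M[K]_M) (r : K)
  (A Ahat C : 'I_M -> 'M[K]_n) (B D : 'I_M -> 'M[K]_(n, k))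
  (Q Qhat : 'I_M -> 'M[K]_n) (Rw : 'I_M -> 'M[K]_k)
  (lam_gen : is_generator lam) (r_gt0 : 0 < r)
  (hC : forall i, posdefmx (r%:M - (A i + (A i)^T + (C i)^T *m C i)))
  (hAhat : forall i,
    posdefmx (r%:M - (A i + (A i)^T + Ahat i + (Ahat i)^T)))
  (Q_ge0 : forall i, possemidefmx (Q i))
  (Qhat_ge0 : forall i, possemidefmx (Qhat i))
  (Rw_gt0 : forall i, posdefmx (Rw i)) :
  exists P : 'I_M -> 'M[K]_n,
    (forall i, possemidefmx (P i)) /\
    solves_coupled_riccati lam r A C B D Q Rw P.
Proof.
have [i|c c0 cQ] := scalar_supersolution (Q := fun i => Q i + 1%:M) lam_gen hC.
  by have [Qs _] := (possemidefmxP _).1 (Q_ge0 i); rewrite trmxD trmx1 Qs.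
have [P Pc dP] := riccati_semidefinite B D lam_gen Rw_gt0 c0 Q_ge0 cQ.
have Pp i : possemidefmx (P i) by case: (Pc i).
by exists P; split=> //; exact: solves_defect.
Qed.
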